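(* Let $\mathcal{C}$ be some set of varieties, and let $\mathcal{C}'\subset\mathcal{C}$. Suppose that for any $X\in\mathcal{C}$ and for any finite group $G\subset\operatorname{Aut}(X)$ there is a variety $X'\in\mathcal{C}'$ with $G\subset\operatorname{Aut}(X')$ and a $G$-equivariant surjective morphism $X'\to X$. Then $\mathcal{C}$ has almost fixed points if and only if $\mathcal{C}'$ does.
   Context: All varieties are over an algebraically closed field of characteristic $0$. A set $\mathcal{C}$ of varieties is said to have almost fixed points if there is a constant $J=J(\mathcal{C})$ such that for any variety $X\in\mathcal{C}$ and for any finite subgroup $G\subset\operatorname{Aut}(X)$ there exists a subgroup $F\subset G$ of index at most $J$ acting on $X$ with a fixed point. *)

(* Defs.v *)
From HB Require Import structures.
From mathcomp Require Import all_boot all_order all_algebra all_fingroup.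
From mathcomp Require Import all_classical topology.
(* The notations of mpoly clash with those of mathcomp-analysis.               *)
From mathcomp Require Import -(notations) mpoly.

Set Implicit Arguments.
Unset Strict Implicit.
Unset Printing Implicit Defensive.

Import GRing.Theory.
Local Open Scope classical_set_scope.
Local Open Scope ring_scope.

(* Varieties are taken in the language of spaces with functions (Serre, FAC;   *)
(* Mumford, Red Book, I.4-I.6): points are closed points, and the structure    *)
(* sheaf is a sheaf of k-valued functions.                                     *)

(* A section over U is represented by any total function extending it, so that *)
(* [regular U f] depends on the restriction of f to U only; the value of       *)
(* [regular U] is irrelevant when U is not open.                               *)
Record funSpace (k : fieldType) := FunSpace {
  funSpace_carrier :> topologicalType;
  regular : set funSpace_carrier -> set (funSpace_carrier -> k);
  regular_eq : forall U f g, open U -> {in U, f =1 g} ->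
    regular U f -> regular U g;
  regular_restrict : forall U V f, open U -> open V -> V `<=` U ->
    regular U f -> regular V f;
  regular_glue : forall U f, open U ->
    (forall x, U x -> exists V, [/\ open V, V x, V `<=` U & regular V f]) ->
    regular U f;
  regular_cst : forall U c, open U -> regular U (cst c);
  regularD : forall U f g, open U ->
    regular U f -> regular U g -> regular U (fun x => f x + g x);
  regularM : forall U f g, open U ->
    regular U f -> regular U g -> regular U (fun x => f x * g x) }.

Definition is_morphism (k : fieldType) (X Y : funSpace k) (f : X -> Y) : Prop :=
  continuous f /\
  forall (U : set Y) (s : Y -> k), open U ->
    regular U s -> regular (f @^-1` U) (s \o f).

Section AffineSpace.
Variables (k : fieldType) (n : nat).

Definition affine_space : Type := 'I_n -> k.

HB.instance Definition _ := Choice.copy affine_space ('I_n -> k).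

Definition zero_locus (P : set (mpoly n k)) : set affine_space :=
  [set x | forall p, P p -> meval x p = 0].

Definition zariski_open : set_system affine_space :=
  [set U | exists P, U = ~` zero_locus P].

Lemma zariski_openT : zariski_open setT.
Proof.
exists setT; apply/esym/seteqP; split=> // x _ /= /(_ 1 I).
by rewrite meval1; apply/eqP/oner_neq0.
Qed.

Lemma zariski_openI : setI_closed zariski_open.
Proof.
move=> _ _ [P ->] [Q ->]; exists [set r | exists p q, [/\ P p, Q q & r = p * q]].
rewrite -setCU; congr (~` _); apply/seteqP; split=> x /=.
  move=> + _ [p [q [Pp Qq ->]]].
  by rewrite mevalM => -[/(_ p Pp)|/(_ q Qq)] ->; rewrite (mul0r, mulr0).
move=> PQ0; have [?|/existsNP[p /not_implyP[Pp p0]]] := pselect (zero_locus P x).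
  by left.
right=> q Qq; have /eqP := PQ0 _ (ex_intro _ p (ex_intro _ q (And3 Pp Qq erefl))).
by rewrite mevalM mulf_eq0 => /orP[] /eqP.
Qed.

Lemma zariski_open_bigU (J : Type) (f : J -> set affine_space) :
  (forall i, zariski_open (f i)) -> zariski_open (\bigcup_i f i).
Proof.
move=> /choice[P fP]; exists (\bigcup_i P i).
rewrite -[LHS]setCK setC_bigcup; congr (~` _); apply/seteqP; split=> x /=.
  by move=> h p [i _ Pp]; have := h i I; rewrite fP setCK; apply.
by move=> h i _; rewrite fP setCK => p Pp; apply: h; exists i.
Qed.

HB.instance Definition _ := isOpenTopological.Build affine_space
  zariski_openT zariski_openI zariski_open_bigU.

End AffineSpace.

Section AffineVariety.
Variables (k : fieldType) (n : nat) (Z : set (affine_space k n)).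

(* [Z], seen as a type, carries the topology induced by the Zariski topology.  *)
Definition affine_regular (U : set Z) : set (Z -> k) :=
  [set f | forall x, U x -> exists (p q : mpoly n k) (V : set Z),
    [/\ open V, V x, V `<=` U & forall y, V y ->
      meval (set_val y) q != 0 /\
      f y = meval (set_val y) p / meval (set_val y) q]].

Lemma affine_regular_eq U f g : open U -> {in U, f =1 g} ->
  affine_regular U f -> affine_regular U g.
Proof.
move=> _ fg Uf x /Uf[p [q [V [oV Vx VU e]]]]; exists p, q, V; split=> // y Vy.
by rewrite -fg; [exact: e|rewrite inE; exact: VU].
Qed.

Lemma affine_regular_restrict U V f : open U -> open V -> V `<=` U ->
  affine_regular U f -> affine_regular V f.
Proof.
move=> _ oV VU Uf x Vx; have [p [q [W [oW Wx WU e]]]] := Uf x (VU _ Vx).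
exists p, q, (W `&` V); split=> //; first exact: openI.
by move=> y [Wy _]; exact: e.
Qed.

Lemma affine_regular_glue U f : open U ->
  (forall x, U x ->
    exists V, [/\ open V, V x, V `<=` U & affine_regular V f]) ->
  affine_regular U f.
Proof.
move=> _ h x /h[V [oV Vx VU /(_ x Vx)[p [q [W [oW Wx WV e]]]]]].
by exists p, q, W; split=> //; exact: subset_trans VU.
Qed.

Lemma affine_regular_cst U c : open U -> affine_regular U (cst c).
Proof.
move=> oU x Ux; exists (mpolyC n c), 1, U; split=> // y _.
by rewrite meval1 mevalC divr1 oner_neq0.
Qed.

Lemma affine_regularD U f g : open U ->
  affine_regular U f -> affine_regular U g ->
  affine_regular U (fun x => f x + g x).
Proof.
move=> _ Uf Ug x Ux; have [p [q [V [oV Vx VU e]]]] := Uf x Ux.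
have [p' [q' [V' [oV' Vx' _ e']]]] := Ug x Ux.
exists (p * q' + p' * q), (q * q'), (V `&` V'); split=> //.
- exact: openI.
- by move=> y [/VU].
move=> y [/e[q0 ->] /e'[q0' ->]].
by rewrite mevalD !mevalM mulf_neq0// addf_div.
Qed.

Lemma affine_regularM U f g : open U ->
  affine_regular U f -> affine_regular U g ->
  affine_regular U (fun x => f x * g x).
Proof.
move=> _ Uf Ug x Ux; have [p [q [V [oV Vx VU e]]]] := Uf x Ux.
have [p' [q' [V' [oV' Vx' _ e']]]] := Ug x Ux.
exists (p * p'), (q * q'), (V `&` V'); split=> //.
- exact: openI.
- by move=> y [/VU].
move=> y [/e[q0 ->] /e'[q0' ->]].
by rewrite !mevalM mulf_neq0// mulf_div.
Qed.

Definition affine_funSpace : funSpace k :=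
  FunSpace affine_regular_eq affine_regular_restrict affine_regular_glue
    affine_regular_cst affine_regularD affine_regularM.

End AffineVariety.

(* An isomorphism of X onto the open subspace [range f] of Y.                  *)
Definition open_immersion (k : fieldType) (X Y : funSpace k) (f : X -> Y) :
    Prop :=
  [/\ injective f, continuous f, (forall U : set X, open U -> open (f @` U)) &
      forall (U : set X) (s : Y -> k), open U ->
        regular (f @` U) s <-> regular U (s \o f)].

Definition affine_open (k : fieldType) (X : funSpace k) (U : set X) : Prop :=
  exists (n : nat) (Z : set (affine_space k n)) (f : affine_funSpace Z -> X),
    [/\ closed Z, open_immersion f & range f = U].

Definition irreducible_space (T : topologicalType) : Prop :=
  [set: T] !=set0 /\
  forall A B : set T, closed A -> closed B -> A `|` B = setT ->
    A = setT \/ B = setT.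

Definition is_prevariety (k : fieldType) (X : funSpace k) : Prop :=
  irreducible_space X /\
  exists (m : nat) (U : 'I_m -> set X),
    (forall i, affine_open (U i)) /\ \bigcup_i U i = setT.

(* By the universal property of X * X in the category of prevarieties, this    *)
(* says that the diagonal of X * X is closed (Mumford, Red Book, I.6).         *)
Definition separated (k : fieldType) (X : funSpace k) : Prop :=
  forall (Y : funSpace k) (f g : Y -> X), is_prevariety Y ->
    is_morphism f -> is_morphism g -> closed [set y | f y = g y].

Record variety (k : closedFieldType) := Variety {
  variety_funSpace :> funSpace k;
  variety_prevariety : is_prevariety variety_funSpace;
  variety_separated : separated variety_funSpace }.

Record AutVar (k : fieldType) (X : funSpace k) := AutOf {
  aut_fun :> X -> X;
  aut_inv : X -> X;
  aut_morphism : is_morphism aut_fun;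
  aut_inv_morphism : is_morphism aut_inv;
  aut_funK : cancel aut_fun aut_inv;
  aut_invK : cancel aut_inv aut_fun }.

Section AutGroup.
Variables (k : fieldType) (X : funSpace k).

Lemma is_morphism_id : is_morphism (@id X).
Proof. by split=> // x; exact: cvg_id. Qed.

Lemma is_morphism_comp (Y Z : funSpace k) (g : Y -> Z) (f : X -> Y) :
  is_morphism g -> is_morphism f -> is_morphism (g \o f).
Proof.
move=> [cg rg] [cf rf]; split.
  by move=> x; exact: continuous_comp (cf x) (cg _).
move=> U s oU Us; apply: (rf (g @^-1` U) (s \o g)); last exact: rg.
by apply: open_comp => // x _; exact: cg.
Qed.

Lemma aut_eqP (a b : AutVar X) : aut_fun a =1 aut_fun b -> a = b.
Proof.
case: a b => [f f' mf mf' fK f'K] [g g' mg mg' gK g'K] /= /funext fg.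
subst g; have e : f' = g' by apply/funext => x; rewrite -{1}(g'K x) fK.
by subst g'; congr AutOf; exact: Prop_irrelevance.
Qed.

Definition aut_one : AutVar X :=
  AutOf is_morphism_id is_morphism_id (fun=> erefl) (fun=> erefl).

Definition aut_invg (a : AutVar X) : AutVar X :=
  AutOf (aut_inv_morphism a) (aut_morphism a)
    (@aut_invK _ _ a) (@aut_funK _ _ a).

End AutGroup.

(* The product is composition of maps: AutVar X acts on X from the left.       *)
Definition aut_mul (k : fieldType) (X : funSpace k) (a b : AutVar X) :
    AutVar X :=
  AutOf (is_morphism_comp (aut_morphism a) (aut_morphism b))
    (is_morphism_comp (aut_inv_morphism b) (aut_inv_morphism a))
    (can_comp (@aut_funK _ _ a) (@aut_funK _ _ b))
    (can_comp (@aut_invK _ _ b) (@aut_invK _ _ a)).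

Section AutGroupInstance.
Variables (k : fieldType) (X : funSpace k).

HB.instance Definition _ := gen_eqMixin (AutVar X).
HB.instance Definition _ := gen_choiceMixin (AutVar X).

Lemma aut_mulA : associative (@aut_mul k X).
Proof. by move=> a b c; exact: aut_eqP. Qed.
Lemma aut_mul1 : left_id (aut_one X) (@aut_mul k X).
Proof. by move=> a; exact: aut_eqP. Qed.
Lemma aut_mulr1 : right_id (aut_one X) (@aut_mul k X).
Proof. by move=> a; exact: aut_eqP. Qed.
Lemma aut_mulV : left_inverse (aut_one X) (@aut_invg k X) (@aut_mul k X).
Proof. by move=> a; apply: aut_eqP => x; exact: (aut_funK a). Qed.
Lemma aut_mulrV : right_inverse (aut_one X) (@aut_invg k X) (@aut_mul k X).
Proof. by move=> a; apply: aut_eqP => x; exact: (aut_invK a). Qed.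

HB.instance Definition _ := isGroup.Build (AutVar X)
  aut_mulA aut_mul1 aut_mulr1 aut_mulV aut_mulrV.

End AutGroupInstance.

(* A finite subgroup of AutVar X is given as the image of an injective group   *)
(* morphism from a [finGroupType], so that one and the same finite group can   *)
(* be contained in AutVar X and in AutVar X'.  C is a predicate rather than a  *)
(* [set]: [variety k] is too large for the universe of [set].                  *)
Definition almost_fixed_points (k : closedFieldType)
    (C : variety k -> Prop) : Prop :=
  exists J : nat, forall X : variety k, C X ->
    forall (gT : finGroupType) (rho : {multiplicative gT -> AutVar X}),
      injective rho ->
      exists F : {group gT}, (#|[set: gT]%G : F|%g <= J)%N /\
        exists x : X, forall g, g \in F -> rho g x = x.

(* Main.v *)
Require Import Defs.
From mathcomp Require Import all_boot all_order all_algebra all_fingroup.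
From mathcomp Require Import all_classical topology.

Theorem lemma4p4 (k : closedFieldType) (char0 : [pchar k]%R =i pred0)
    (C C' : variety k -> Prop) (subC : forall X : variety k, C' X -> C X)
    (cover : forall X : variety k, C X ->
       forall (gT : finGroupType) (rho : {multiplicative gT -> AutVar X}),
         injective rho ->
         exists (X' : variety k) (rho' : {multiplicative gT -> AutVar X'})
                (phi : X' -> X),
           C' X' /\
           injective rho' /\
           is_morphism phi /\
           (forall x : X, exists x' : X', phi x' = x) /\
           (forall (g : gT) (x' : X'), phi (rho' g x') = rho g (phi x'))) :
  almost_fixed_points C <-> almost_fixed_points C'.
Proof.
split=> -[J fixJ]; exists J => X CX gT rho rho_inj.
  exact: fixJ X (subC X CX) gT rho rho_inj.
have [X' [rho' [phi [C'X' [rho'_inj [_ [_ phiE]]]]]]] := cover X CX gT rho rho_inj.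
have [F [leFJ [x' fix_x']]] := fixJ X' C'X' gT rho' rho'_inj.
by exists F; split=> //; exists (phi x') => g Fg; rewrite -phiE fix_x'.
Qed.
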